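(* Let $k\ge 1$ and $n$ be positive integers. Then $\chi_k\circ\Delta_k=\chi_k$; that is, $\chi_k(\Delta_k(P))=\chi_k(P)$ for every $n$-gon $P=(P_1,\dots,P_n)$ in the real projective plane for which all the quantities involved are defined.
   Context: Here only the cyclically ordered list of vertices $P_j$, $j\in\mathbb Z/n$, of the $n$-gon matters. Indices are mod $n$ and $P_{a,b}$ denotes the line through $P_a$ and $P_b$. The $n$-gon $\Delta_k(P)$ has as its $j$-th vertex the point $P_{j,j+k+1}\cap P_{j+1,j-k}$. Define the cross ratio $\chi(a,b,c,d)=\dfrac{(a-b)(c-d)}{(a-c)(b-d)}$. Let $\sigma_{a,b}$ be the slope of the line $P_{a,b}$ (in an affine patch; the cross ratio of the slopes of four lines through a common point is the projectively invariant cross ratio of those lines, so the choice of patch is irrelevant and infinite slopes are allowed). The $k$-energy is $$\chi_k(P)=\prod_{i=1}^n \chi(i,k,P),\qquad \chi(i,k,P)=\chi(\sigma_{i,i-k},\sigma_{i,i-k-1},\sigma_{i,i+k+1},\sigma_{i,i+k}).$$ ''All quantities are defined'' means: the lines and intersection points used to define $\chi_k(P)$, $\Delta_k(P)$ and $\chi_k(\Delta_k(P))$ are well defined (the relevant points, respectively lines, are distinct), and the cross ratio factors of $\chi_k(P)$ and of $\chi_k(\Delta_k(P))$ all have nonzero denominators. No bird, niceness or planarity hypothesis is required. *)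

(* Defs.v *)
From mathcomp Require Import all_boot all_order all_algebra.
From mathcomp Require Import reals.
Set Implicit Arguments.
Unset Strict Implicit.
Unset Printing Implicit Defensive.
Import Order.TTheory GRing.Theory Num.Theory.
Local Open Scope ring_scope.

(* The projective plane is the set of lines through the origin of R^3: a point
   is a 1-dimensional subspace, a line a 2-dimensional one; the line through
   two distinct points is their sum, and two distinct lines meet in their
   intersection. *)

(* The vertices are indexed by Z/n, that is, by n-periodic maps on int. *)
Definition ngon (R : realType) (n : nat) (P : int -> {vspace 'rV[R]_3}) : Prop :=
  (forall j, \dim (P j) = 1%N) /\ (forall j, P (j + n%:Z) = P j).

Definition join_line (R : realType) (P : int -> {vspace 'rV[R]_3}) (a b : int) :
  {vspace 'rV[R]_3} := (P a + P b)%VS.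

Definition Delta (R : realType) (k : nat) (P : int -> {vspace 'rV[R]_3}) :
  int -> {vspace 'rV[R]_3} :=
  fun j => (join_line P j (j + k%:Z + 1) :&: join_line P (j + 1) (j - k%:Z))%VS.

Definition Delta_defined (R : realType) (k : nat)
    (P : int -> {vspace 'rV[R]_3}) : Prop :=
  forall j : int,
    [/\ P j <> P (j + k%:Z + 1),
        P (j + 1) <> P (j - k%:Z) &
        join_line P j (j + k%:Z + 1) <> join_line P (j + 1) (j - k%:Z)].

(* A matrix M stands for the affine patch obtained by applying the projective
   transformation v |-> v *m M and dividing by the last coordinate. *)
Definition hcoord (R : realType) (M : 'M[R]_3) (p : {vspace 'rV[R]_3}) : 'rV[R]_3 :=
  vpick p *m M.

Definition affine_patch (R : realType) (M : 'M[R]_3)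
    (P : int -> {vspace 'rV[R]_3}) : Prop :=
  M \in unitmx /\ forall j, hcoord M (P j) 0 2%:R != 0.

Definition xcoord (R : realType) (M : 'M[R]_3) (p : {vspace 'rV[R]_3}) : R :=
  hcoord M p 0 0 / hcoord M p 0 2%:R.

Definition ycoord (R : realType) (M : 'M[R]_3) (p : {vspace 'rV[R]_3}) : R :=
  hcoord M p 0 1 / hcoord M p 0 2%:R.

(* [None] is the slope of a vertical line. *)
Definition slope (R : realType) (M : 'M[R]_3) (P : int -> {vspace 'rV[R]_3})
    (a b : int) : option R :=
  if xcoord M (P a) == xcoord M (P b) then None
  else Some ((ycoord M (P b) - ycoord M (P a)) /
             (xcoord M (P b) - xcoord M (P a))).

(* Difference of slopes. In a cross ratio each slope occurs once in the
   numerator and once in the denominator, so the factors containing an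
   infinite slope cancel up to sign: replacing oo - x by 1 and x - oo by -1
   gives the limit value. *)
Definition slope_sub (R : realType) (a b : option R) : R :=
  match a, b with
  | Some x, Some y => x - y
  | None, Some _ => 1
  | Some _, None => -1
  | None, None => 0
  end.

Definition chi_num (R : realType) (a b c d : option R) : R :=
  slope_sub a b * slope_sub c d.

Definition chi_den (R : realType) (a b c d : option R) : R :=
  slope_sub a c * slope_sub b d.

Definition chi (R : realType) (a b c d : option R) : R :=
  chi_num a b c d / chi_den a b c d.

Definition chi_at (R : realType) (M : 'M[R]_3) (k : nat)
    (P : int -> {vspace 'rV[R]_3}) (i : int) : R :=
  chi (slope M P i (i - k%:Z)) (slope M P i (i - k%:Z - 1))
      (slope M P i (i + k%:Z + 1)) (slope M P i (i + k%:Z)).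

Definition energy (R : realType) (M : 'M[R]_3) (n k : nat)
    (P : int -> {vspace 'rV[R]_3}) : R :=
  \prod_(1 <= i < n.+1) chi_at M k P i%:Z.

Definition energy_defined (R : realType) (M : 'M[R]_3) (k : nat)
    (P : int -> {vspace 'rV[R]_3}) : Prop :=
  forall i : int,
    [/\ P i <> P (i - k%:Z), P i <> P (i - k%:Z - 1),
        P i <> P (i + k%:Z + 1), P i <> P (i + k%:Z) &
        chi_den (slope M P i (i - k%:Z)) (slope M P i (i - k%:Z - 1))
                (slope M P i (i + k%:Z + 1)) (slope M P i (i + k%:Z)) != 0].

(* Every n-gon has an affine patch, so that quantifying over the patches
   containing all its vertices excludes no n-gon. *)
Lemma affine_patch_exists (R : realType) (n : nat) (P : int -> {vspace 'rV[R]_3}) :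
  (0 < n)%N -> ngon n P -> exists M, affine_patch M P.
Proof.
move=> n0 [dimP perP].
have perPm j (m : nat) : P (j + m%:Z * n%:Z) = P j.
  elim: m => [|m IH]; first by rewrite mul0r addr0.
  by rewrite intS mulrDl mul1r [n%:Z + _]addrC addrA perP.
have nz : n%:Z != 0 by case: (n) n0.
have perPz j : P j = P (absz (j %% n%:Z)%Z)%:Z.
  rewrite gez0_abs ?modz_ge0 //.
  have := divz_eq j n%:Z; case: (j %/ n%:Z)%Z => m e.
    by rewrite {1}e addrC perPm.
  by rewrite {1}e NegzE -(perPm _ m.+1) addrAC mulNr addNr add0r.
pose v j := vpick (P j).
pose q j : {poly R} := \poly_(i < 3) v j 0 (rev_ord (inord i : 'I_3)).
have q_neq0 j : q j != 0.
  apply/eqP => q0; have : vpick (P j) != 0.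
    by rewrite vpick0 -dimv_eq0 dimP.
  move/eqP; apply; apply/rowP => i; rewrite mxE.
  have := congr1 (fun p : {poly R} => p`_(rev_ord i)) q0.
  by rewrite coef_poly coef0 ltn_ord inord_val rev_ordK.
pose Q := \prod_(0 <= j < n) q j%:Z.
have Q_neq0 : Q != 0 by rewrite /Q prodf_seq_neq0; apply/allP => j _ /=.
have [t Qt] : exists t : R, ~~ root Q t.
  pose s : seq R := [seq i%:R | i <- iota 0 (size Q)].
  have [/hasP[t _ Qt]|/hasPn noroot] := boolP (has (fun t => ~~ root Q t) s).
    by exists t.
  have : (size s < size Q)%N.
    apply: max_poly_roots => //.
      by apply/allP => t /noroot; rewrite negbK.
    by rewrite map_inj_uniq ?iota_uniq //; apply: mulrIn; apply: oner_neq0.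
  by rewrite size_map size_iota ltnn.
pose M : 'M[R]_3 :=
  \matrix_(i, j) if j == 2%:R then t ^+ (rev_ord i) else (i == j)%:R.
exists M; split.
  rewrite unitmxE -det_tr det_trig; last first.
    apply/is_trig_mxP => i j ij; rewrite !mxE.
    case: eqP => [i2|_]; last by case: eqP => // ji; rewrite ji ltnn in ij.
    by move: ij; rewrite i2 /= ltnNge -ltnS ltn_ord.
  rewrite big1 ?unitr1 // => i _; rewrite !mxE.
  by case: eqP => [->|_]; rewrite ?expr0 ?eqxx.
move=> j; rewrite perPz; set m := absz _.
have mn : (m < n)%N.
  by rewrite -ltz_nat gez0_abs ?modz_ge0 // ltz_pmod // ltz_nat.
have qt : ~~ root (q m%:Z) t.
  apply: contraNN Qt; rewrite /root /Q horner_prod => /eqP qt0.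
  by rewrite (big_rem m) ?mem_index_iota //= qt0 mul0r.
apply: contraNneq qt; rewrite /hcoord mxE => e.
rewrite /root /q horner_poly -[X in _ == X]e; apply/eqP.
rewrite (reindex_inj rev_ord_inj) /=; apply: eq_bigr => i _.
rewrite [M i _]mxE eqxx; congr (v m%:Z 0 _ * _).
by rewrite -[X in inord X]/(nat_of_ord (rev_ord i)) inord_val rev_ordK.
Qed.

(* Main.v *)
Require Import Defs.
From mathcomp Require Import all_boot all_order all_algebra.
From mathcomp Require Import reals.
From mathcomp Require Import boolp ring lra.
Set Implicit Arguments.
Unset Strict Implicit.
Unset Printing Implicit Defensive.
Import Order.TTheory GRing.Theory Num.Theory.
Local Open Scope ring_scope.

(** Why the energy is invariant.

    Choose vectors p_j of R^3 spanning the vertices P_j and write [u v w] for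
    the determinant of three vectors.  In any affine patch, a difference of
    slopes of lines P_iP_a and P_iP_b is [p_i p_a p_b] times factors that cancel
    in a cross ratio ([slope_sub_bracket], [chi_bracket]), also when one of the
    lines is vertical.  So each factor of the energy is
      [i,i-k,i-k-1] [i,i+k+1,i+k] / ([i,i-k,i+k+1] [i,i-k-1,i+k]),
    and it does not change when the p_j are rescaled.

    Let l_j = p_j x p_(j+k+1) be the covector of the line P_jP_(j+k+1).  The
    j-th vertex of the image polygon is the meet of the lines l_j and l_(j-k),
    hence is spanned by q_j = l_j x l_(j-k) ([vpick_Delta]).

    The computation rests on one identity, used twice:
      [a x b, b x c, d x e] = [a b c] [b d e]      ([bracket_cross]).
    The points q_i and q_(i-k) both lie on the line l_(i-k).  The identity
    therefore turns every bracket of q's in the i-th factor into a bracket of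
    l's, at the cost of triples [l l l] which are the same in numerator and
    denominator.  Dually, the lines l_j and l_(j-k-1) both pass through p_j, and
    the identity turns the remaining brackets of l's into brackets of p's.
    With A_j = [p_(j-k-1) p_j p_(j+k+1)], and B_j C_j / (D_j E_j) the j-th factor of
    the energy of P, its brackets in the order above, the i-th factor for the image polygon is
      A_(i-k) A_(i+k+1) B_i C_(i+1) / (A_(i+1) A_i D_(i+k+1) E_(i-k))
    ([pencil_num_meet], [pencil_den_meet]).  All indices are shifts of i, so in
    the product over a period the A's cancel and the rest is the energy of P. *)

(** * Brackets and cross products in dimension three *)

Lemma ord3P (i : 'I_3) : [\/ i = 0, i = 1 | i = 2%:R].
Proof.
by case: i => [[|[|[|//]]] lt3]; [constructor 1|constructor 2|constructor 3];
  apply: val_inj.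
Qed.

Lemma sum_ord3 (V : nmodType) (F : 'I_3 -> V) :
  \sum_i F i = F 0 + F 1 + F 2%:R.
Proof.
rewrite !big_ord_recl big_ord0 addr0 addrA.
by do ![congr (_ + _)]; congr F; apply: val_inj.
Qed.

Lemma row3P (T : Type) (u v : 'rV[T]_3) :
  u 0 0 = v 0 0 -> u 0 1 = v 0 1 -> u 0 2%:R = v 0 2%:R -> u = v.
Proof. by move=> u0 u1 u2; apply/rowP => j; case: (ord3P j) => ->. Qed.

Definition bracket (R : comPzRingType) (u v w : 'rV[R]_3) : R :=
  u 0 0 * (v 0 1 * w 0 2%:R - v 0 2%:R * w 0 1)
  - u 0 1 * (v 0 0 * w 0 2%:R - v 0 2%:R * w 0 0)
  + u 0 2%:R * (v 0 0 * w 0 1 - v 0 1 * w 0 0).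

Definition cross (R : comPzRingType) (u v : 'rV[R]_3) : 'rV[R]_3 :=
  \row_j (if j == 0 then u 0 1 * v 0 2%:R - u 0 2%:R * v 0 1
          else if j == 1 then u 0 2%:R * v 0 0 - u 0 0 * v 0 2%:R
          else u 0 0 * v 0 1 - u 0 1 * v 0 0).

Lemma crossE (R : comPzRingType) (u v : 'rV[R]_3) :
  (cross u v 0 0 = u 0 1 * v 0 2%:R - u 0 2%:R * v 0 1) *
  (cross u v 0 1 = u 0 2%:R * v 0 0 - u 0 0 * v 0 2%:R) *
  (cross u v 0 2%:R = u 0 0 * v 0 1 - u 0 1 * v 0 0).
Proof. by rewrite !mxE. Qed.

Lemma bracketC12 (R : comPzRingType) (u v w : 'rV[R]_3) :
  bracket v u w = - bracket u v w.
Proof. by rewrite /bracket; ring. Qed.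

Lemma bracketC23 (R : comPzRingType) (u v w : 'rV[R]_3) :
  bracket u w v = - bracket u v w.
Proof. by rewrite /bracket; ring. Qed.

Lemma bracket_rot (R : comPzRingType) (u v w : 'rV[R]_3) :
  bracket v w u = bracket u v w.
Proof. by rewrite /bracket; ring. Qed.

Lemma bracketZ (R : comPzRingType) (a b c : R) (u v w : 'rV[R]_3) :
  bracket (a *: u) (b *: v) (c *: w) = a * b * c * bracket u v w.
Proof. by rewrite /bracket !mxE; ring. Qed.

(** By the double cross product formula [(a x b) x (b x c)] is [[a b c]] times
    [b]: two planes spanned by pairs that share [b] meet along [b]. *)
Lemma bracket_cross (R : comPzRingType) (a b c d e : 'rV[R]_3) :
  bracket (cross a b) (cross b c) (cross d e) = bracket a b c * bracket b d e.
Proof. by rewrite /bracket !crossE; ring. Qed.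

Lemma bracket_mulmx (R : comPzRingType) (M : 'M[R]_3) (u v w : 'rV[R]_3) :
  bracket (u *m M) (v *m M) (w *m M) =
  bracket u v w * bracket (row 0 M) (row 1 M) (row 2%:R M).
Proof. by rewrite /bracket !mxE !sum_ord3; ring. Qed.

(** Cramer's rule: the coordinates of [v] in the basis [(a, b, e)]. *)
Lemma bracket_cramer (R : comPzRingType) (a b e v : 'rV[R]_3) :
  bracket a b e *: v =
  bracket v b e *: a + bracket a v e *: b + bracket a b v *: e.
Proof. by apply: row3P; rewrite !mxE /bracket; ring. Qed.

(** The bracket of the rows is the determinant of [M]; multiplicativity applied
    to the inverse matrix shows that it is nonzero without expanding it. *)
Lemma bracket_rows_unit (R : fieldType) (M : 'M[R]_3) :
  M \in unitmx -> bracket (row 0 M) (row 1 M) (row 2%:R M) != 0.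
Proof.
move=> uM; pose N := invmx M.
have := bracket_mulmx M (row 0 N) (row 1 N) (row 2%:R N).
rewrite -!row_mul mulVmx // => e; apply/eqP => M0; move: e.
rewrite M0 mulr0 /bracket !mxE /= !(mulr0, mul0r, mulr1, subr0, addr0).
by move/eqP; rewrite oner_eq0.
Qed.

Definition dot (R : comPzRingType) (u v : 'rV[R]_3) : R :=
  u 0 0 * v 0 0 + u 0 1 * v 0 1 + u 0 2%:R * v 0 2%:R.

Lemma dot_self_neq0 (R : realFieldType) (u : 'rV[R]_3) : u != 0 -> dot u u != 0.
Proof.
by apply: contra_neq; rewrite /dot => e; apply: row3P; rewrite mxE; nra.
Qed.

Lemma dot_crossl (R : comPzRingType) (u v w : 'rV[R]_3) :
  dot (cross u v) w = bracket u v w.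
Proof. by rewrite /dot /bracket !crossE; ring. Qed.

Lemma cross_crossl (R : comPzRingType) (u v w : 'rV[R]_3) :
  cross (cross u v) w = dot u w *: v - dot v w *: u.
Proof. by apply: row3P; rewrite !(crossE, mxE) /= /dot; ring. Qed.

Lemma crossC (R : comPzRingType) (u v : 'rV[R]_3) : cross v u = - cross u v.
Proof. by apply: row3P; rewrite !(crossE, mxE) /=; ring. Qed.

Lemma crossNr (R : comPzRingType) (u v : 'rV[R]_3) : cross u (- v) = - cross u v.
Proof. by apply: row3P; rewrite !(crossE, mxE) /=; ring. Qed.

Lemma cross0l (R : comPzRingType) (u : 'rV[R]_3) : cross 0 u = 0.
Proof. by apply: row3P; rewrite !(crossE, mxE) /=; ring. Qed.

(** If [u x v = 0], the triple product [(u x v) x u = (u.u) v - (v.u) u] vanishes,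
    and [u.u <> 0] because squares are nonnegative. *)
Lemma cross_eq0_colinear (R : realFieldType) (u v : 'rV[R]_3) :
  u != 0 -> cross u v = 0 -> exists c, v = c *: u.
Proof.
move=> /dot_self_neq0 u0 uv0; exists (dot v u / dot u u).
have /eqP := cross_crossl u v u; rewrite uv0 cross0l eq_sym subr_eq0 => /eqP e.
by rewrite mulrC -scalerA -e scalerA mulVf // scale1r.
Qed.

(** * Points and lines as subspaces *)

Section Points.
Variable R : realType.
Implicit Types (A B C D : {vspace 'rV[R]_3}).

Lemma vpick_line A : \dim A = 1%N -> A = <[vpick A]>%VS.
Proof.
move=> dA; apply/eqP; rewrite eq_sym eqEdim -memvE memv_pick /= dA dim_vline.
by rewrite vpick0 -dimv_eq0 dA.
Qed.

Lemma vpick_point_neq0 A : \dim A = 1%N -> vpick A != 0.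
Proof. by move=> dA; rewrite vpick0 -dimv_eq0 dA. Qed.

Lemma eq_point A B (c : R) : \dim A = 1%N -> \dim B = 1%N ->
  vpick B = c *: vpick A -> A = B.
Proof.
move=> dA dB e; apply/eqP; rewrite eq_sym eqEdim dA dB leqnn andbT.
by rewrite (vpick_line dB) e -memvE memvZ ?memv_pick.
Qed.

Lemma cross_vpick_neq0 A B : \dim A = 1%N -> \dim B = 1%N -> A <> B ->
  cross (vpick A) (vpick B) != 0.
Proof.
move=> dA dB AB; apply/eqP => /cross_eq0_colinear [|c e].
  exact: vpick_point_neq0.
by apply: AB; apply: eq_point e.
Qed.

Lemma mem_join A B v : \dim A = 1%N -> \dim B = 1%N -> A <> B ->
  v \in (A + B)%VS = (bracket (vpick A) (vpick B) v == 0).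
Proof.
move=> dA dB AB; apply/idP/eqP => [|v0].
  rewrite {1}(vpick_line dA) {1}(vpick_line dB).
  case/memv_addP => _ /vlineP[s ->] [_ /vlineP[t ->] ->].
  by rewrite /bracket !mxE; ring.
have := bracket_cramer (vpick A) (vpick B) (cross (vpick A) (vpick B)) v.
rewrite v0 scale0r addr0.
(* The normal of the plane completes the two points to a basis: the bracket
   [d] is the squared length of the normal. *)
set d := bracket _ _ (cross _ _) => e.
have d0 : d != 0.
  by rewrite /d -dot_crossl dot_self_neq0 // cross_vpick_neq0.
rewrite -(scalerK d0 v) e memvZ // memv_add // memvZ // memv_pick //.
Qed.

(** Vanishing of the double cross product says that the two normals are
    proportional, that is, that the planes have the same equation. *)
Lemma join_sub A B C D : \dim A = 1%N -> \dim B = 1%N -> A <> B ->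
  \dim C = 1%N -> \dim D = 1%N -> C <> D ->
  cross (cross (vpick A) (vpick B)) (cross (vpick C) (vpick D)) = 0 ->
  (C + D <= A + B)%VS.
Proof.
move=> dA dB AB dC dD CD.
rewrite crossC => /eqP; rewrite oppr_eq0 => /eqP.
case/cross_eq0_colinear => [|c e]; first exact: cross_vpick_neq0.
rewrite (vpick_line dC) (vpick_line dD) subv_add -!memvE !mem_join //.
rewrite -!dot_crossl e /dot !mxE /=.
by apply/andP; split; apply/eqP; ring.
Qed.

(** A vector common to both planes is orthogonal to both normals, hence parallel
    to their cross product, which is nonzero because the planes differ. *)
Lemma meet_joinE A B C D (l := cross (vpick A) (vpick B))
    (m := cross (vpick C) (vpick D)) :
  \dim A = 1%N -> \dim B = 1%N -> A <> B ->
  \dim C = 1%N -> \dim D = 1%N -> C <> D -> (A + B)%VS <> (C + D)%VS ->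
  cross l m != 0 /\ ((A + B) :&: (C + D))%VS = <[cross l m]>%VS.
Proof.
move=> dA dB AB dC dD CD neq.
have lm0 : cross l m != 0.
  apply/eqP => lm0; apply: neq; apply/eqP; rewrite eqEsubv.
  by rewrite !join_sub // crossC -/l -/m lm0 oppr0.
split=> //; apply/eqP; rewrite eqEsubv; apply/andP; split.
  apply/subvP => v; rewrite memv_cap !mem_join // -!dot_crossl -/l -/m.
  case/andP=> /eqP lv /eqP mv; apply/vlineP.
  by apply: cross_eq0_colinear; rewrite // cross_crossl lv mv !scale0r subr0.
rewrite -memvE memv_cap !mem_join // -!dot_crossl -/l -/m /dot !crossE.
by apply/andP; split; apply/eqP; ring.
Qed.

End Points.

(** * Invariance of the bracket energy *)

Lemma prod_periodic_shift (R : comPzRingType) (n : nat) (F : int -> R) (m : int) :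
  (forall j, F (j + n%:Z) = F j) ->
  \prod_(1 <= i < n.+1) F (i%:Z + m) = \prod_(1 <= i < n.+1) F i%:Z.
Proof.
have shift1 (G : int -> R) : (forall j, G (j + n%:Z) = G j) ->
    \prod_(1 <= i < n.+1) G (i%:Z + 1) = \prod_(1 <= i < n.+1) G i%:Z.
  case: n => [|n] perG; first by rewrite !big_nil.
  rewrite big_nat_recr // [RHS]big_nat_recl //= mulrC addrC perG.
  by congr (_ * _); apply: eq_bigr => i _; rewrite -[in RHS]addn1 PoszD.
have shiftn (d : nat) (G : int -> R) : (forall j, G (j + n%:Z) = G j) ->
    \prod_(1 <= i < n.+1) G (i%:Z + d%:Z) = \prod_(1 <= i < n.+1) G i%:Z.
  move=> perG; elim: d => [|d IH]; first by apply: eq_bigr => i _; rewrite addr0.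
  rewrite -IH -(shift1 (fun j => G (j + d%:Z))); last first.
    by move=> j; rewrite addrAC perG.
  by apply: eq_bigr => i _; rewrite -addrA intS.
case: m => d perF; first exact: shiftn.
rewrite -(shiftn d.+1 (fun j => F (j + Negz d))).
  by apply: eq_bigr => i _; rewrite NegzE addrK.
by move=> j; rewrite addrAC perF.
Qed.

(** Numerator and denominator of the cross ratio of the four lines through
    [p i], with brackets in place of differences of slopes. *)
Definition pencil_num (R : comPzRingType) (k : nat) (p : int -> 'rV[R]_3) (i : int) : R :=
  bracket (p i) (p (i - k%:Z)) (p (i - k%:Z - 1)) *
  bracket (p i) (p (i + k%:Z + 1)) (p (i + k%:Z)).

Definition pencil_den (R : comPzRingType) (k : nat) (p : int -> 'rV[R]_3) (i : int) : R :=
  bracket (p i) (p (i - k%:Z)) (p (i + k%:Z + 1)) *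
  bracket (p i) (p (i - k%:Z - 1)) (p (i + k%:Z)).

Definition diagonal (R : comPzRingType) (k : nat) (p : int -> 'rV[R]_3) (j : int) :
  'rV[R]_3 := cross (p j) (p (j + k%:Z + 1)).

Definition diagonal_meet (R : comPzRingType) (k : nat) (p : int -> 'rV[R]_3) (j : int) :
  'rV[R]_3 := cross (diagonal k p j) (diagonal k p (j - k%:Z)).

Section Telescope.
Variables (R : comPzRingType) (k : nat) (p : int -> 'rV[R]_3).

Local Notation l := (diagonal k p).
Local Notation q := (diagonal_meet k p).

Definition point_triple (j : int) : R :=
  bracket (p (j - k%:Z - 1)) (p j) (p (j + k%:Z + 1)).

Definition line_triple (j : int) : R :=
  bracket (l j) (l (j - k%:Z)) (l (j - k%:Z - k%:Z)).

(** [q i] and [q (i - k)] lie on the common line [l (i - k)]. *)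
Lemma bracket_meet_prev i j : bracket (q i) (q (i - k%:Z)) (q j) =
  line_triple i * bracket (l (i - k%:Z)) (l j) (l (j - k%:Z)).
Proof. exact: bracket_cross. Qed.

(** [q i] and [q (i + k)] lie on the common line [l i]. *)
Lemma bracket_meet_next i j : bracket (q i) (q (i + k%:Z)) (q j) =
  - (line_triple (i + k%:Z) * bracket (l i) (l j) (l (j - k%:Z))).
Proof.
by have := bracket_meet_prev (i + k%:Z) j; rewrite addrK bracketC12 => <-; rewrite opprK.
Qed.

(** The dual incidence: [l (j - k - 1)] and [l j] pass through [p j]. *)
Lemma bracket_diagonal j m : bracket (l (j - k%:Z - 1)) (l j) (l m) =
  point_triple j * bracket (p j) (p m) (p (m + k%:Z + 1)).
Proof.
rewrite /diagonal (_ : j - k%:Z - 1 + k%:Z + 1 = j); last by ring.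
exact: bracket_cross.
Qed.

(** The factor common to [pencil_num] and [pencil_den] of the image polygon. *)
Definition triple_weight (i : int) := line_triple i * line_triple (i + k%:Z).

(** Each bracket of the [q]'s contains [q i] and one of its neighbours
    [q (i - k)], [q (i + k)], so it reduces to a bracket of lines; two of these
    lines are again consecutive diagonals through a vertex of [p]. *)
Lemma pencil_num_meet i : pencil_num k q i =
  triple_weight i * (point_triple (i - k%:Z) * point_triple (i + k%:Z + 1)) *
  (bracket (p i) (p (i - k%:Z)) (p (i - k%:Z - 1)) *
   bracket (p (i + 1)) (p (i + 1 + k%:Z + 1)) (p (i + 1 + k%:Z))).
Proof.
have e1 : bracket (l (i - k%:Z)) (l (i - k%:Z - 1)) (l (i - k%:Z - 1 - k%:Z)) =
    point_triple (i - k%:Z) * bracket (p i) (p (i - k%:Z)) (p (i - k%:Z - 1)).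
  rewrite (_ : i - k%:Z - 1 - k%:Z = i - k%:Z - k%:Z - 1); last by ring.
  rewrite bracket_rot bracket_diagonal bracket_rot.
  by rewrite (_ : i - k%:Z - 1 + k%:Z + 1 = i); last by ring.
have e2 : bracket (l i) (l (i + k%:Z + 1)) (l (i + k%:Z + 1 - k%:Z)) =
    point_triple (i + k%:Z + 1) *
    bracket (p (i + 1)) (p (i + 1 + k%:Z + 1)) (p (i + 1 + k%:Z)).
  rewrite (_ : i + k%:Z + 1 - k%:Z = i + 1); last by ring.
  rewrite {1}(_ : i = i + k%:Z + 1 - k%:Z - 1); last by ring.
  rewrite bracket_diagonal -bracket_rot.
  by rewrite (_ : i + 1 + k%:Z = i + k%:Z + 1); last by ring.
rewrite /pencil_num bracket_meet_prev (bracketC23 (q i)) bracket_meet_next e1 e2.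
by rewrite /triple_weight; ring.
Qed.

Lemma pencil_den_meet i : pencil_den k q i =
  triple_weight i * (point_triple (i + 1) * point_triple i) *
  (bracket (p (i + k%:Z + 1)) (p (i + k%:Z + 1 - k%:Z))
     (p (i + k%:Z + 1 + k%:Z + 1)) *
   bracket (p (i - k%:Z)) (p (i - k%:Z - k%:Z - 1)) (p (i - k%:Z + k%:Z))).
Proof.
have e1 : bracket (l (i - k%:Z)) (l (i + k%:Z + 1)) (l (i + k%:Z + 1 - k%:Z)) =
    point_triple (i + 1) * bracket (p (i + k%:Z + 1)) (p (i + k%:Z + 1 - k%:Z))
     (p (i + k%:Z + 1 + k%:Z + 1)).
  rewrite (_ : i + k%:Z + 1 - k%:Z = i + 1); last by ring.
  rewrite (_ : i - k%:Z = i + 1 - k%:Z - 1); last by ring.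
  by rewrite bracketC23 bracket_diagonal -mulrN -bracketC12.
have e2 : bracket (l i) (l (i - k%:Z - 1)) (l (i - k%:Z - 1 - k%:Z)) =
    point_triple i * bracket (p (i - k%:Z)) (p (i - k%:Z - k%:Z - 1))
      (p (i - k%:Z + k%:Z)).
  rewrite bracketC12 bracket_diagonal -mulrN -bracketC23.
  rewrite (_ : i - k%:Z - 1 - k%:Z + k%:Z + 1 = i - k%:Z); last by ring.
  rewrite (_ : i - k%:Z - 1 - k%:Z = i - k%:Z - k%:Z - 1); last by ring.
  by rewrite subrK -bracket_rot.
rewrite /pencil_den bracket_meet_prev (bracketC23 (q i) (q (i + k%:Z))).
by rewrite bracket_meet_next e1 e2 /triple_weight; ring.
Qed.

End Telescope.

Definition pencil_energy (R : fieldType) (n k : nat) (p : int -> 'rV[R]_3) : R :=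
  \prod_(1 <= i < n.+1) (pencil_num k p i%:Z / pencil_den k p i%:Z).

(** The brackets of [p] that occur in the image polygon's factors are those of
    its own factors at shifted indices, so the products over a period agree.
    The point triples cancel because nonzero denominators of the image polygon
    force them to be nonzero. *)
Lemma pencil_energy_meet (R : fieldType) (n k : nat) (p : int -> 'rV[R]_3) :
  (forall j, p (j + n%:Z) = p j) ->
  (forall j, pencil_den k (diagonal_meet k p) j != 0) ->
  pencil_energy n k (diagonal_meet k p) = pencil_energy n k p.
Proof.
move=> perp den0; set q := diagonal_meet k p in den0 *.
pose A := point_triple k p.
pose B i := bracket (p i) (p (i - k%:Z)) (p (i - k%:Z - 1)).
pose C i := bracket (p i) (p (i + k%:Z + 1)) (p (i + k%:Z)).
pose D i := bracket (p i) (p (i - k%:Z)) (p (i + k%:Z + 1)).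
pose E i := bracket (p i) (p (i - k%:Z - 1)) (p (i + k%:Z)).
pose W := triple_weight k p.
have perp' x y : x = y + n%:Z -> p x = p y by move=> ->.
have perA j : A (j + n%:Z) = A j.
  by rewrite /A /point_triple; congr bracket; apply: perp'; ring.
have perB j : B (j + n%:Z) = B j by congr bracket; apply: perp'; ring.
have perC j : C (j + n%:Z) = C j by congr bracket; apply: perp'; ring.
have perD j : D (j + n%:Z) = D j by congr bracket; apply: perp'; ring.
have perE j : E (j + n%:Z) = E j by congr bracket; apply: perp'; ring.
have numq i : pencil_num k q i =
  W i * (A (i - k%:Z) * A (i + k%:Z + 1) * (B i * C (i + 1))).
  by rewrite mulrA; exact: pencil_num_meet.
have denq i : pencil_den k q i =
  W i * (A (i + 1) * A i * (D (i + k%:Z + 1) * E (i - k%:Z))).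
  by rewrite mulrA; exact: pencil_den_meet.
have /all_and2[W0 A0] i : W i != 0 /\ A i != 0.
  by have := den0 i; rewrite denq !mulf_eq0 !negb_or => /and3P[? /andP[]].
have ratioq i : pencil_num k q i / pencil_den k q i =
  A (i - k%:Z) * A (i + (k%:Z + 1)) / (A (i + 1) * A i) *
  (B i * C (i + 1) / (D (i + (k%:Z + 1)) * E (i - k%:Z))).
  by rewrite numq denq addrA -mulf_div divff // mul1r -mulf_div.
rewrite /pencil_energy (eq_bigr _ (fun i _ => ratioq i%:Z)).
rewrite [RHS](eq_bigr (fun i : nat => B i%:Z * C i%:Z / (D i%:Z * E i%:Z))) //.
rewrite !(big_split, prodfV) /=.
rewrite !(prod_periodic_shift _ perA) !(prod_periodic_shift _ perC).
rewrite !(prod_periodic_shift _ perD) !(prod_periodic_shift _ perE).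
rewrite divff ?mul1r // mulf_neq0 //; rewrite prodf_seq_neq0;
  by apply/allP => i _; rewrite A0.
Qed.

(** * From slopes to brackets *)

Section Slopes.
Variables (R : realType) (M : 'M[R]_3) (P : int -> {vspace 'rV[R]_3}).
Hypotheses (dimP : forall j, \dim (P j) = 1%N) (patch : affine_patch M P).

(** What the line from [P i] to [P a] contributes to the denominator of a
    difference of slopes: its run, times the last coordinate that normalizes
    [P a].  For a vertical line the rise takes the place of the run, so that
    [slope_sub_bracket] covers the formal infinite slope too. *)
Definition secant_scale (i a : int) : R :=
  hcoord M (P a) 0 2%:R *
  (if xcoord M (P i) == xcoord M (P a) then ycoord M (P a) - ycoord M (P i)
   else xcoord M (P a) - xcoord M (P i)).

(** A zero factor means that the two points have the same affine coordinates in
    the patch, hence coincide. *)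
Lemma secant_scale_neq0 i a : P i <> P a -> secant_scale i a != 0.
Proof.
case: patch => uM w0 neq; rewrite mulf_neq0 //.
case: ifPn => [/eqP ex|]; last by rewrite subr_eq0 eq_sym.
rewrite subr_eq0; apply/eqP => ey; apply: neq.
pose c := hcoord M (P a) 0 2%:R / hcoord M (P i) 0 2%:R.
apply: (eq_point (c := c)) => //; apply: (row_free_inj (A := M)).
  by rewrite row_free_unit.
rewrite -scalemxAl -!/(hcoord M _).
have xE j : hcoord M (P j) 0 0 = xcoord M (P j) * hcoord M (P j) 0 2%:R.
  by rewrite divfK.
have yE j : hcoord M (P j) 0 1 = ycoord M (P j) * hcoord M (P j) 0 2%:R.
  by rewrite divfK.
apply: row3P; rewrite [fun_of_matrix (_ *: _) _ _]mxE /c.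
- by rewrite !xE ex mulrCA; congr (_ * _); rewrite divfK.
- by rewrite !yE ey mulrCA; congr (_ * _); rewrite divfK.
- by rewrite divfK ?w0.
Qed.

(** After dividing by the last coordinates, the determinant is the area form on
    the two edge vectors from [P i]. *)
Lemma bracket_hcoord i a b :
  bracket (hcoord M (P i)) (hcoord M (P a)) (hcoord M (P b)) =
  hcoord M (P i) 0 2%:R * hcoord M (P a) 0 2%:R * hcoord M (P b) 0 2%:R *
  ((xcoord M (P a) - xcoord M (P i)) * (ycoord M (P b) - ycoord M (P i)) -
   (ycoord M (P a) - ycoord M (P i)) * (xcoord M (P b) - xcoord M (P i))).
Proof.
case: patch => _ w0; rewrite /bracket /xcoord /ycoord.
by field; rewrite !w0.
Qed.

(** A difference of slopes [dy/dx - dy'/dx'] is the area [dy dx' - dy' dx] over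
    [dx dx']; the factor in front depends on the patch and on [i] only. *)
Lemma slope_sub_bracket i a b : P i <> P a -> P i <> P b ->
  slope_sub (slope M P i a) (slope M P i b) =
  - bracket (row 0 M) (row 1 M) (row 2%:R M) / hcoord M (P i) 0 2%:R
  * (bracket (vpick (P i)) (vpick (P a)) (vpick (P b))
     / (secant_scale i a * secant_scale i b)).
Proof.
move=> /secant_scale_neq0 + /secant_scale_neq0; case: patch => uM w0.
rewrite mulf_div mulNr [X in - X / _]mulrC -bracket_mulmx -!/(hcoord M _).
rewrite bracket_hcoord /slope /secant_scale /slope_sub.
move: (w0 i) (w0 a) (w0 b).
move: (hcoord M (P i) 0 2%:R) (hcoord M (P a) 0 2%:R) (hcoord M (P b) 0 2%:R).
move: (xcoord M (P i)) (xcoord M (P a)) (xcoord M (P b)).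
move: (ycoord M (P i)) (ycoord M (P a)) (ycoord M (P b)).
move=> yi ya yb xi xa xb wi wa wb i0 a0 b0.
case: (xi =P xa) => [<-|_]; case: (xi =P xb) => [<-|_];
  rewrite !mulf_eq0 !negb_or => /andP[_ da] /andP[_ db]; field;
  by rewrite ?i0 ?a0 ?b0 ?da ?db.
Qed.

(** Each of the four lines occurs once in the numerator and once in the
    denominator of a cross ratio, so both carry the same factor. *)
Lemma chi_bracket i a b c d (p := fun j => vpick (P j)) :
  P i <> P a -> P i <> P b -> P i <> P c -> P i <> P d ->
  exists2 s : R, s != 0 &
    chi_num (slope M P i a) (slope M P i b) (slope M P i c) (slope M P i d) =
      s * (bracket (p i) (p a) (p b) * bracket (p i) (p c) (p d)) /\
    chi_den (slope M P i a) (slope M P i b) (slope M P i c) (slope M P i d) =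
      s * (bracket (p i) (p a) (p c) * bracket (p i) (p b) (p d)).
Proof.
move=> ia ib ic id.
have sa := secant_scale_neq0 ia; have sb := secant_scale_neq0 ib.
have sc := secant_scale_neq0 ic; have sd := secant_scale_neq0 id.
pose t := - bracket (row 0 M) (row 1 M) (row 2%:R M) / hcoord M (P i) 0 2%:R.
have t0 : t != 0.
  case: patch => uM w0.
  by rewrite mulf_neq0 ?invr_eq0 // oppr_eq0 bracket_rows_unit.
exists (t ^+ 2 / (secant_scale i a * secant_scale i b * secant_scale i c *
                  secant_scale i d)).
  rewrite mulf_neq0 ?expf_neq0 // invr_eq0.
  by do 3!(apply: mulf_neq0 => //).
rewrite /chi_num /chi_den !slope_sub_bracket // -/t -!/(p _).
by split; field; rewrite sa sb sc sd.
Qed.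

End Slopes.

(** * The energy of the image polygon *)

Lemma energy_pencil (R : realType) (M : 'M[R]_3) (n k : nat)
    (P : int -> {vspace 'rV[R]_3}) (p := fun j => vpick (P j)) :
  (forall j, \dim (P j) = 1%N) -> affine_patch M P -> energy_defined M k P ->
  energy M n k P = pencil_energy n k p /\ forall i, pencil_den k p i != 0.
Proof.
move=> dimP patch def.
have chiE i : chi_at M k P i = pencil_num k p i / pencil_den k p i /\
    pencil_den k p i != 0.
  case: (def i) => ia ib ic id; rewrite /chi_at /chi.
  have [s s0 [-> ->]] := chi_bracket dimP patch ia ib ic id.
  rewrite mulf_eq0 negb_or => /andP[_ den0].
  by rewrite -mulf_div divff // mul1r.
split=> [|i]; last by case: (chiE i).
by apply: eq_bigr => i _; case: (chiE i%:Z).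
Qed.

Lemma pencil_scale (R : comPzRingType) (k : nat) (p q : int -> 'rV[R]_3)
    (c : int -> R) i :
  (forall j, p j = c j *: q j) ->
  let s := c i ^+ 2 * c (i - k%:Z) * c (i - k%:Z - 1) * c (i + k%:Z + 1) *
           c (i + k%:Z) in
  pencil_num k p i = s * pencil_num k q i /\ pencil_den k p i = s * pencil_den k q i.
Proof.
by move=> pE s; rewrite /pencil_num /pencil_den !pE !bracketZ /s; split; ring.
Qed.

Lemma pencil_energy_scale (R : fieldType) (n k : nat) (p q : int -> 'rV[R]_3)
    (c : int -> R) :
  (forall j, c j != 0) -> (forall j, p j = c j *: q j) ->
  pencil_energy n k p = pencil_energy n k q.
Proof.
move=> c0 pE; apply: eq_bigr => i _; have [-> ->] := pencil_scale k i%:Z pE.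
by rewrite -mulf_div divff ?mul1r // !mulf_neq0 // expf_neq0.
Qed.

(** The second line of the definition of the image vertex joins [P (j + 1)] to
    [P (j - k)], which is the diagonal of index [j - k] with its ends swapped. *)
Lemma vpick_Delta (R : realType) (k : nat) (P : int -> {vspace 'rV[R]_3})
    (p := fun j => vpick (P j)) j :
  (forall j, \dim (P j) = 1%N) -> Delta_defined k P ->
  \dim (Delta k P j) = 1%N /\
  exists2 c, c != 0 & vpick (Delta k P j) = c *: diagonal_meet k p j.
Proof.
move=> dimP /(_ j)[d1 d2 d3].
have [] := meet_joinE (dimP _) (dimP _) d1 (dimP _) (dimP _) d2 d3.
rewrite -/(Delta k P j); set x := cross _ _ => x0 DE.
have xE : x = - diagonal_meet k p j.
  rewrite /diagonal_meet /diagonal subrK -/(p _) /x -!/(p _).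
  by rewrite (crossC (p (j - k%:Z))) crossNr.
have dD : \dim (Delta k P j) = 1%N by rewrite DE dim_vline x0.
split=> //; have : vpick (Delta k P j) \in <[x]>%VS by rewrite -DE memv_pick.
case/vlineP => c e; exists (- c).
  rewrite oppr_eq0; apply: contra_neq (vpick_point_neq0 dD) => c0.
  by rewrite e c0 scale0r.
by rewrite e xE scaleNr scalerN.
Qed.

Theorem theorem1p2 (R : realType) (k n : nat) (hk : (1 <= k)%N) (hn : (1 <= n)%N)
    (P : int -> {vspace 'rV[R]_3}) (hP : ngon n P)
    (hDelta : Delta_defined k P)
    (M M' : 'M[R]_3)
    (hM : affine_patch M P) (hM' : affine_patch M' (Delta k P))
    (hE : energy_defined M k P) (hE' : energy_defined M' k (Delta k P)) :
  energy M' n k (Delta k P) = energy M n k P.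
Proof.
case: hP => dimP perP; pose p j := vpick (P j).
have DE j := vpick_Delta j dimP hDelta.
have dimD j : \dim (Delta k P j) = 1%N by case: (DE j).
have /choice[c cE] : forall j, exists c : R,
    c != 0 /\ vpick (Delta k P j) = c *: diagonal_meet k p j.
  by move=> j; have [_ [c c0 e]] := DE j; exists c.
have {}DE j : vpick (Delta k P j) = c j *: diagonal_meet k p j by case: (cE j).
have c0 j : c j != 0 by case: (cE j).
have [-> denP] := energy_pencil n dimP hM hE.
have [-> denD] := energy_pencil n dimD hM' hE'.
rewrite (pencil_energy_scale n k c0 DE); apply: pencil_energy_meet => j.
  by rewrite /p perP.
have := denD j; have [_ ->] := pencil_scale k j DE.
by rewrite mulf_eq0 negb_or => /andP[].
Qed.
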